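(* Let $k\ge2$ and $1\le t<2^k-1$, and let $R$ and $Z$ be the numbers of ones and zeros in the $k$-bit word of $t$. If $R<Z$, then $$|S_{t,k}|<2^{k-1}.$$
   Context: For an integer $n\ge0$, $\operatorname{wt}(n)$ is the number of ones in its binary expansion. For $k\ge2$, $N=2^k-1$ and $1\le t\le N-1$, $$S_{t,k}=\{(a,b)\in\{0,\ldots,N-1\}^2: a+b\equiv t \pmod N,\ \operatorname{wt}(a)+\operatorname{wt}(b)<k\}.$$ The $k$-bit word of $t$ is its binary expansion padded with zeros to length $k$. *)

(* Defs.v *)
From mathcomp Require Import all_boot.

Set Implicit Arguments.
Unset Strict Implicit.
Unset Printing Implicit Defensive.

Definition bit (n i : nat) : bool := odd (n %/ 2 ^ i).

(* Least significant digit first; this is the zero-padded k-bit word of n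
   when n < 2 ^ k (otherwise the high digits are dropped). *)
Definition word (k n : nat) : seq bool := mkseq (bit n) k.

(* For n > 0, n has (trunc_log 2 n).+1 binary digits; binary 0 is the
   single digit 0. *)
Definition binary (n : nat) : seq bool := word (trunc_log 2 n).+1 n.

Definition wt (n : nat) : nat := count_mem true (binary n).

Definition Stk (t k : nat) : {set 'I_(2 ^ k - 1) * 'I_(2 ^ k - 1)} :=
  [set ab : 'I_(2 ^ k - 1) * 'I_(2 ^ k - 1) |
    (ab.1 + ab.2 == t %[mod 2 ^ k - 1]) && (wt ab.1 + wt ab.2 < k)].

(* Main.v *)
(** Adding [a] and [b] modulo [2^k - 1] produces a closed cyclic word of carries
along the word of [t], and [wt a + wt b] is [R] plus the number of carries.
Following the carries is following a sequence [u] of coin tosses: a toss is due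
at each letter equal to the current carry, and its outcome is the next carry.
The generating polynomial [tr] of closed carry words satisfies
[v^k - tr + x^Z w^R = (v - x - w) Q], where [x], [w], [v] mark an outcome 0, an
outcome 1 and a letter without toss.  Deleting the zeros of the cyclic word one
after the other shows that [Q] enumerates words [u] that survive, survival being
the embedding of a part of [u] as a subsequence of what is left of the word.
Averaged over the zero at which the cyclic word is opened, survival can only
improve when a 1 is deleted from [u]; counting deletions, the words with [j+1]
zeros and [j+1] ones weigh at most twice those with [j+1] zeros and [j] ones.
Setting [x = 1], [w = X^2], [v = 2X] and telescoping the factor [-(1 - X)^2]
gives [|S| <= 2^(k-1) + 1] minus a sum of nonnegative terms, in which the
words with [R] zeros and [R - 1] ones alone contribute at least 2. *)

Require Import Defs.
From mathcomp Require Import all_boot all_algebra zify ring.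

Set Implicit Arguments.
Unset Strict Implicit.
Unset Printing Implicit Defensive.

Import GRing.Theory.
Local Open Scope ring_scope.

(** * Carry words, transfer matrices and toss histories *)

Section Transfer.

Variables (R : comNzRingType) (x w v : R).

(* When [c == t] the two digits added are equal and determine the outgoing carry;
   otherwise they differ, in two possible ways, and the carry is unchanged. *)
Fixpoint transfer (l : seq bool) (c d : bool) : R :=
  if l is t :: l' then
    if c == t then x * transfer l' false d + w * transfer l' true d
    else v * transfer l' c d
  else (c == d)%:R.

Definition trace (l : seq bool) : R :=
  transfer l false false + transfer l true true.

Definition defect (l : seq bool) : R :=
  v ^+ size l - trace l + x ^+ count_mem false l * w ^+ count_mem true l.

Lemma transfer_cat s l c d :
  transfer (s ++ l) c d =
  transfer s c false * transfer l false d + transfer s c true * transfer l true d.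
Proof.
elim: s c => [|t s IH] c /=; first by case: c => /=; ring.
by case: ifP => _; rewrite !IH; ring.
Qed.

Lemma defect_rot s l : defect (s ++ l) = defect (l ++ s).
Proof.
by rewrite /defect /trace !transfer_cat !size_cat !count_cat addnC
  (addnC (count_mem false s)) (addnC (count_mem true s)); ring.
Qed.

(** From carry 0 no toss is ever due, which gives [v ^+ n]; a closed carry word from 1 must toss 1
    at every letter, which gives [w ^+ n]. *)
Lemma defect_ones n : defect (nseq n true) = 0.
Proof.
have H0 d : transfer (nseq n true) false d = v ^+ n * (false == d)%:R.
  by elim: n => [|n IH] /=; rewrite ?IH ?exprS; ring.
have H1 : transfer (nseq n true) true true = w ^+ n.
  have H0' m : transfer (nseq m true) false true = 0.
    by elim: m => [|m IH] //=; rewrite IH mulr0.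
  by elim: n {H0} => [|n IH] //=; rewrite IH H0' exprS; ring.
by rewrite /defect /trace H0 H1 size_nseq !count_nseq /= mul0n mul1n; ring.
Qed.

(* The sum over the words [u] of length at most [N - 1] with [F u], homogenized by
   [v] to degree [N - 1]; see [wsum_words]. *)
Fixpoint wsum (N : nat) (F : seq bool -> bool) : R :=
  if N is N'.+1 then
    (F [::])%:R * v ^+ N' + x * wsum N' (F \o cons false) + w * wsum N' (F \o cons true)
  else 0.

Lemma eq_wsum N F G : F =1 G -> wsum N F = wsum N G.
Proof.
elim: N F G => //= N IH F G FG; rewrite FG.
by congr (_ + _ * _ + _ * _); apply: IH => u; apply: FG.
Qed.

Lemma wsum0 N F : (forall u, F u = false) -> wsum N F = 0.
Proof.
elim: N F => //= N IH F F0; rewrite F0 mul0r !IH ?mulr0 ?addr0 // => u; exact: F0.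
Qed.

Lemma wsum_pad N F : (forall u, (N <= size u)%N -> F u = false) ->
  wsum N.+1 F = v * wsum N F.
Proof.
elim: N F => [|N IH] F F0.
  by rewrite /= F0 // !mulr0 mul0r !addr0.
have wsumS M G : wsum M.+1 G =
  (G [::])%:R * v ^+ M + x * wsum M (G \o cons false) + w * wsum M (G \o cons true) by [].
rewrite [LHS]wsumS (wsumS N F) !IH; first by rewrite exprS; ring.
all: by move=> u Hu; apply: F0.
Qed.

(* Tosses outlive [l], from carry [c], exactly when [c :: u] embeds in [l]: the
   greedy embedding visits the letters at which the tosses are due. *)
Definition live c l := wsum (size l) (fun u => subseq (c :: u) l).
Definition live1 c l := wsum (size l) (fun u => subseq (rcons (c :: u) true) l).

Lemma live_cons c l :
  live c (c :: l) = v ^+ size l + x * live false l + w * live true l.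
Proof. rewrite /live /= eqxx sub0seq mul1r; congr (_ + _ * _ + _ * _);

  by apply: eq_wsum => u /=; rewrite eqxx.
Qed.

Lemma live_skip c t l : c != t -> live c (t :: l) = v * live c l.
Proof.
move=> /negbTE ct; rewrite /live [size (_ :: _)]/=.
rewrite -wsum_pad; first by apply: eq_wsum => u /=; rewrite ct.
by move=> u Hu; apply/negbTE; apply: contraL Hu => /size_subseq; rewrite -ltnNge.
Qed.

Lemma live1_cons c l :
  live1 c (c :: l) =
  (true \in l)%:R * v ^+ size l + x * live1 false l + w * live1 true l.
Proof.
rewrite /live1 /= eqxx sub1seq; congr (_ + _ * _ + _ * _);
  by apply: eq_wsum => u /=; rewrite eqxx.
Qed.

Lemma live1_skip c t l : c != t -> live1 c (t :: l) = v * live1 c l.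
Proof.
move=> /negbTE ct; rewrite /live1 [size (_ :: _)]/=.
rewrite -wsum_pad; first by apply: eq_wsum => u /=; rewrite ct.
by move=> u Hu; apply/negbTE; apply: contraL Hu => /size_subseq;
  rewrite /= size_rcons -ltnNge => /ltnW.
Qed.

(** A Kraft identity: [live] lists the toss histories after which another toss is due, and each such
    toss replaces a factor [v] by [x + w]; the two transfers list the finished runs. *)
Lemma live_kraft c l :
  (v - x - w) * live c l = v ^+ size l - transfer l c false - transfer l c true.
Proof.
elim: l c => [|t l IH] c; first by rewrite /live /=; case: c => /=; ring.
have [->|ct] := eqVneq c t.
  by rewrite live_cons /= eqxx exprS mulrDr mulrDr; have := IH false; have := IH true => H1 H0;
  rewrite !(mulrCA (v - x - w)) H0 H1; ring.
by rewrite (live_skip _ ct) /= (negbTE ct) mulrCA IH exprS; ring.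
Qed.

(** If [c :: u] embeds but [rcons (c :: u) true] does not, a toss is due after [u], and outcome 1
    there is the last toss. All runs ending in carry 1 arise so, except the one from carry 1 without
    any toss. *)
Lemma live_live1 c l :
  w * (live c l - live1 c l) =
  transfer l c true - (c && (true \notin l))%:R * v ^+ size l.
Proof.
elim: l c => [|t l IH] c; first by rewrite /live /live1 /=; case: c => /=; ring.
have [->|ct] := eqVneq c t.
  rewrite live_cons live1_cons /= eqxx (_ : t && _ = false); last by case: t.
  have Efalse : transfer l false true = w * (live false l - live1 false l).
    by rewrite IH /=; ring.
  have Etrue : transfer l true true =
      w * (live true l - live1 true l) + (true \notin l)%:R * v ^+ size l.
    by rewrite IH /=; ring.
  by rewrite Efalse Etrue; case: (true \in l) => /=; ring.
rewrite !(live_skip _ ct) !(live1_skip _ ct) /= (negbTE ct) -mulrBr mulrCA IH in_cons exprS.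
by case: c t ct => [] [] //= _; ring.
Qed.

(** Enumerates the words [u], empty or beginning with 1, for which [rcons u true] embeds in [l];
    these are released when a zero is deleted. *)
Definition emit l : R := (true \in l)%:R * v ^+ size l + w * live1 true l.

Lemma emitE l : emit l = v ^+ size l - transfer l true true + w * live true l.
Proof.
have := live_live1 true l; rewrite /emit /= => H.
have -> : transfer l true true = w * (live true l - live1 true l) + (true \notin l)%:R * v ^+ size l.
  by rewrite H; ring.
by case: (true \in l) => /=; ring.
Qed.

Lemma defect_cons0 l : defect (false :: l) = x * defect l + (v - x - w) * emit l.
Proof.
rewrite emitE /defect /trace /= add0n.
(* Isolating [(v - x - w) * live true l] lets [live_kraft] bring in [transfer l true false], which
   the toss at the leading zero creates. *)
have -> : (v - x - w) * (v ^+ size l - transfer l true true + w * live true l) =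
  (v - x - w) * (v ^+ size l - transfer l true true) + w * ((v - x - w) * live true l) by ring.
by rewrite live_kraft !exprS; ring.
Qed.

End Transfer.

(** * The cyclic word as blocks of ones, and survival *)

Section Circle.

Implicit Types (b : seq nat) (u : seq bool).

Definition encode b : seq bool := flatten [seq false :: nseq i true | i <- b].

Lemma size_encode b : size (encode b) = (size b + sumn b)%N.
Proof. by elim: b => //= i b IH; rewrite size_cat size_nseq IH; lia. Qed.

Lemma count_encode b t :
  count_mem t (encode b) = if t then sumn b else size b.
Proof.
case: t; elim: b => //= i b IH.
  by rewrite count_cat count_nseq -/(encode b) IH /= mul1n.
by rewrite count_cat count_nseq -/(encode b) IH /= mul0n.
Qed.

(* The cyclic word [encode b] opened after its first letter, with the last [m]
   zeros erased. *)
Definition tail b m : seq bool :=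
  behead (encode (take (size b - m) b)) ++ nseq (sumn (drop (size b - m) b)) true.

Definition circle b m : seq bool :=
  encode (take (size b - m) b) ++ nseq (sumn (drop (size b - m) b)) true.

Lemma circleE b m : (m < size b)%N -> circle b m = false :: tail b m.
Proof.
rewrite /circle /tail; case: b => [|i b] //= ltmb.
by rewrite subSn //= -/(encode _).
Qed.

Lemma circle0 b : circle b 0 = encode b.
Proof. by rewrite /circle subn0 take_size drop_size cats0. Qed.

Lemma circle_size b m : m = size b -> circle b m = nseq (sumn b) true.
Proof. by move=> ->; rewrite /circle subnn take0 drop0. Qed.

Lemma size_circle b m : (m <= size b)%N ->
  (size (circle b m) + m)%N = (size b + sumn b)%N.
Proof.
move=> lemb; have := sumn_cat (take (size b - m) b) (drop (size b - m) b).
rewrite cat_take_drop size_cat size_encode size_nseq size_take_min => ->.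
by rewrite (minn_idPl (leq_subr _ _)); lia.
Qed.

(** Rotation by one block makes the opening zero the last one, so that it joins the erased zeros; up
    to this rotation only the first run of ones moves. *)
Lemma tail_split b m : (m < size b)%N ->
  exists i l, tail b m = nseq i true ++ l /\ circle (rot 1 b) m.+1 = l ++ nseq i true.
Proof.
case: b => [|i b] //= ltmb.
exists i, (encode (take (size b - m) b) ++ nseq (sumn (drop (size b - m) b)) true).
rewrite /tail /circle /= subSn //= -/(encode _) -catA; split=> //.
rewrite rot1_cons size_rcons subSS -cats1 takel_cat ?leq_subr //.
have -> : drop (size b - m) (b ++ [:: i]) = drop (size b - m) b ++ [:: i].
  rewrite drop_cat; case: ltnP => // le.
  by rewrite (_ : size b - m = size b)%N ?drop_size ?subnn ?drop0 //; lia.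
by rewrite sumn_cat /= addn0 nseqD catA.
Qed.

(* The leading zeros of [u] count the zeros erased from the cyclic word. *)
Fixpoint surv b m u : bool :=
  if u is false :: u' then surv b m.+1 u'
  else (m < size b)%N && subseq (rcons u true) (tail b m).

Lemma surv_oversize b m u : (size b <= m)%N -> surv b m u = false.
Proof.
elim: u m => [|[] u IH] m le /=; try by rewrite ltnNge le.
by rewrite IH // leqW.
Qed.

Lemma sum_rot (V : nmodType) (F : seq nat -> V) b :
  \sum_(i < size b) F (rot 1 (rot i b)) = \sum_(i < size b) F (rot i b).
Proof.
rewrite -(big_mkord xpredT (fun i => F (rot i b))).
rewrite -(big_mkord xpredT (fun i => F (rot 1 (rot i b)))).
case: b => [|n b]; first by rewrite !big_geq.
rewrite [RHS]big_nat_recl // big_nat_recr //= rot0 addrC; congr (_ + _).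
  by rewrite -rotS ?rot_oversize //=.
by apply: eq_big_nat => i /andP[_ lti]; rewrite -rotS //= ltnW.
Qed.

Lemma sub_ones_cat i u l :
  subseq (false :: u) (nseq i true ++ l) -> subseq (false :: u) l.
Proof. by elim: i. Qed.

(* [surv] without the special role of the leading zeros of [u]: the two agree
   unless [u] starts with a zero, and summed over the rotations of [b] [fits] is
   the smaller. *)
Definition fits b m u := (m < size b)%N && subseq (rcons u true) (tail b m).

(** The leading 0 is matched past the first run of ones, hence no earlier than the next zero, where
    the rotated circle opens; [u] embeds after it. *)
Lemma fits_step b m u : fits b m (false :: u) -> fits (rot 1 b) m.+1 u.
Proof.
case/andP=> ltmb /=; have [i [l [-> E]]] := tail_split ltmb.
move=> /sub_ones_cat sub; rewrite /fits size_rot.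
have := size_circle ltmb; case: ltnP => [lt|ge] _.
  move: E; rewrite circleE ?size_rot //; case: l sub => // -[] l.
    by case: i.
  rewrite /= => sub [->]; exact: subseq_trans sub (prefix_subseq _ _).
have em : m.+1 = size (rot 1 b) by rewrite size_rot; lia.
move: E; rewrite (circle_size em) => E.
have : false \in l ++ nseq i true.
  by rewrite mem_cat (mem_subseq sub) // inE eqxx.
by rewrite -E mem_nseq andbF.
Qed.

Definition mass b m u : nat := (\sum_(i < size b) surv (rot i b) m u)%N.

Lemma mass_fits b m u : (\sum_(i < size b) fits (rot i b) m u <= mass b m u)%N.
Proof.
elim: u m => [|[] u IH] m //.
apply: leq_trans (IH m.+1).
(* The rotation spent by [fits_step] is harmless in a sum over all rotations. *)
rewrite -(sum_rot (fun b => fits b m.+1 u : nat)).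
apply: leq_sum => i _; have := @fits_step (rot i b) m u.
by case: (fits _ _ (_ :: _)) => //= ->.
Qed.

Lemma leq_fits b m u1 u2 : subseq u1 u2 -> (fits b m u2 <= fits b m u1)%N.
Proof.
move=> sub; rewrite /fits; case: (m < _)%N => //=.
case: (boolP (subseq (rcons u2 _) _)) => // sub2.
by rewrite (subseq_trans _ sub2) // -!cats1 cat_subseq.
Qed.

(** If only zeros precede the deleted 1, zeros of [u2] may become leading and change their role in
    [surv]; by [mass_fits] this costs nothing in the sum over rotations. Otherwise a shorter
    subsequence embeds more easily. *)
Lemma mass_delete b m u1 u2 :
  (mass b m (u1 ++ true :: u2) <= mass b m (u1 ++ u2))%N.
Proof.
elim: u1 m => [|[] u1 IH] m; last exact: IH.
  apply: leq_trans (mass_fits b m u2); apply: leq_sum => i _.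
  exact: leq_fits (subseq_cons _ _).
apply: leq_sum => i _; apply: (@leq_fits _ _ (true :: _) (true :: _)).
by rewrite /= cat_subseq // subseq_cons.
Qed.

Lemma count_tail b m : (m < size b)%N -> count_mem true (tail b m) = sumn b.
Proof.
move=> ltmb; rewrite -[LHS]add0n -[LHS]/(count_mem true (false :: tail b m)).
rewrite -circleE // /circle count_cat count_encode count_nseq mul1n.
by rewrite -sumn_cat cat_take_drop.
Qed.

(** The embedding uses one further 1 after [u], and erasing zeros leaves exactly [sumn b] ones. *)
Lemma surv_count b m u : surv b m u -> (count_mem true u < sumn b)%N.
Proof.
elim: u m => [|[] u IH] m /=; last exact: IH.
all: case/andP=> ltmb /(leq_count_subseq (pred1 true)).
all: rewrite count_tail //= -cats1 count_cat /=; lia.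
Qed.

Lemma mass_le b m u : (mass b m u <= size b)%N.
Proof.
rewrite -[X in (_ <= X)%N]card_ord -sum1_card; apply: leq_sum => i _.
by case: surv.
Qed.

Lemma surv_full b m n : (m < size b)%N -> (n < sumn b)%N ->
  surv b 0 (nseq m false ++ nseq n true).
Proof.
move=> ltmb ltnb; have skip j u : surv b j (nseq m false ++ u) = surv b (m + j) u.
  by elim: m {ltmb} j => //= m IH j; rewrite IH addnS.
rewrite skip addn0.
have : subseq (nseq n.+1 true) (tail b m).
  apply: (@subseq_trans _ (nseq (sumn b) true)).
    by rewrite -(subnKC ltnb) nseqD prefix_subseq.
  rewrite -(count_tail ltmb) -size_filter.
  have /all_pred1P <- := filter_all (pred1 true) (tail b m).
  exact: filter_subseq.
rewrite -addn1 nseqD cats1.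
by case: n {ltnb} => [|n] /= sub; rewrite ltmb.
Qed.

Lemma mass_full b m n : (m < size b)%N -> (n < sumn b)%N ->
  mass b 0 (nseq m false ++ nseq n true) = size b.
Proof.
move=> ltmb ltnb; rewrite -[RHS]card_ord -sum1_card; apply: eq_bigr => i _.
by rewrite surv_full ?size_rot ?sumn_rot.
Qed.

End Circle.

(** * Deleting all zeros, summed over the rotations *)

Section DefectCircle.

Variables (R : comNzRingType) (x w v : R).

Lemma wsum_surv b m : (m < size b)%N ->
  wsum x w v (size (circle b m)) (surv b m) =
  emit x w v (tail b m) + x * wsum x w v (size (tail b m)) (surv b m.+1).
Proof.
move=> ltmb; rewrite circleE // [size (_ :: _)]/= [LHS]/= /emit /live1 ltmb sub1seq.
have -> : wsum x w v (size (tail b m)) (surv b m \o cons true) =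
    wsum x w v (size (tail b m)) (fun u => subseq (rcons (true :: u) true) (tail b m)).
  by apply: eq_wsum => u /=; rewrite ltmb.
by rewrite [RHS]addrAC.
Qed.

Lemma sum_defect b m : (m <= size b)%N ->
  \sum_(i < size b) defect x w v (circle (rot i b) m) =
  (v - x - w) * \sum_(i < size b) wsum x w v (size b + sumn b - m) (surv (rot i b) m).
Proof.
move def_d : (size b - m)%N => d; elim: d m def_d => [|d IH] m def_d lemb.
  have em : m = size b by lia.
  rewrite [in LHS]big1 => [|i _]; last first.
    by rewrite circle_size ?size_rot // defect_ones.
  rewrite [in RHS]big1 ?mulr0 // => i _.
  by apply: wsum0 => u; rewrite surv_oversize // size_rot em.
have ltmb : (m < size b)%N by lia.
(* Delete the opening zero, then rotate by one block. *)
have step i : defect x w v (circle (rot i b) m) =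
    x * defect x w v (circle (rot 1 (rot i b)) m.+1) +
    (v - x - w) * emit x w v (tail (rot i b) m).
  rewrite circleE ?size_rot // defect_cons0.
  have [a [l [-> ->]]] : exists a l, tail (rot i b) m = nseq a true ++ l /\
    circle (rot 1 (rot i b)) m.+1 = l ++ nseq a true by apply: tail_split; rewrite size_rot.
  by rewrite defect_rot.
rewrite (eq_bigr _ (fun (i : 'I__) _ => step i)) big_split -!big_distrr /=.
rewrite (sum_rot (fun b => defect x w v (circle b m.+1))) IH; [|lia|lia].
rewrite mulrCA -mulrDr; congr (_ * _).
rewrite big_distrr -big_split /=; apply: eq_bigr => i _.
have sz : size (tail (rot i b) m) = (size b + sumn b - m.+1)%N.
  have := @size_circle (rot i b) m; rewrite circleE ?size_rot //= sumn_rot => /(_ (ltnW ltmb)); lia.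
have -> : (size b + sumn b - m = size (circle (rot i b) m))%N.
  by rewrite circleE ?size_rot //= sz; lia.
by rewrite wsum_surv ?size_rot // sz addrC.
Qed.

End DefectCircle.

(** * Words by length and number of ones *)

Fixpoint words n : seq (seq bool) :=
  if n is n'.+1 then map (cons false) (words n') ++ map (cons true) (words n')
  else [:: [::]].

Lemma sum_wordsS (V : nmodType) n (F : seq bool -> V) :
  \sum_(u <- words n.+1) F u =
  \sum_(u <- words n) F (false :: u) + \sum_(u <- words n) F (true :: u).
Proof. by rewrite big_cat !big_map. Qed.

Lemma size_words n u : u \in words n -> size u = n.
Proof.
elim: n u => [|n IH] u /=; first by rewrite inE => /eqP ->.
by rewrite mem_cat => /orP[] /mapP[u' /IH <- ->].
Qed.

Lemma mem_words u : u \in words (size u).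
Proof.
elim: u => [|[] u IH] //=; rewrite mem_cat; apply/orP; [right|left];
  exact: map_f.
Qed.

Lemma wsum_words (R : comNzRingType) (x w v : R) N F :
  wsum x w v N F =
  \sum_(0 <= n < N) \sum_(u <- words n)
    (F u)%:R * v ^+ (N - n.+1) * x ^+ count_mem false u * w ^+ count_mem true u.
Proof.
elim: N F => [|N IH] F; first by rewrite big_geq.
rewrite big_nat_recl // big_seq1 /= !IH subn1 /= !mulr1 -addrA; congr (_ + _).
rewrite !big_distrr -big_split /=; apply: eq_big_nat => n /andP[_ ltnN].
rewrite sum_wordsS !big_distrr /= subSS; congr (_ + _); apply: eq_bigr => u _;
  by rewrite /= ?add0n ?add1n exprS; ring.
Qed.

Definition del p (u : seq bool) := take p u ++ drop p.+1 u.

Lemma sum_del n p (F : seq bool -> nat) : (p <= n)%N ->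
  (\sum_(u <- words n.+1 | nth false u p) F (del p u) = \sum_(u <- words n) F u)%N.
Proof.
elim: n p F => [|n IH] [|p] F lepn //; rewrite big_mkcond (@sum_wordsS nat) /=.
- by rewrite !big_seq1.
- by rewrite big1 ?add0r //; apply: eq_bigr => u _; rewrite /del /= drop0.
by rewrite -!big_mkcond (@sum_wordsS nat n) -!(IH p).
Qed.

Arguments words : simpl never.

Definition level b n j : nat := (\sum_(u <- words n | count_mem true u == j) mass b 0 u)%N.

(** Double counting of words with a marked 1: a word of the upper level has [j.+1] marks, and for
    each of the [n.+1] positions deleting the mark is injective and does not lower the mass. *)
Lemma level_step b n j :
  (j.+1 * level b n.+1 j.+1 <= n.+1 * level b n j)%N.
Proof.
have E p : (p < n.+1)%N -> (\sum_(u <- words n.+1 | (count_mem true u == j.+1) && nth false u p) mass b 0 u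
   <= level b n j)%N.
  move=> ltpn; rewrite /level [X in (_ <= X)%N]big_mkcond -(@sum_del n p) //.
  rewrite big_mkcondl /= big_seq_cond [X in (_ <= X)%N]big_seq_cond.
  apply: leq_sum => u; case/andP=> uw up; have su := size_words uw.
  have Eu : u = take p u ++ true :: drop p.+1 u.
    by rewrite -up -drop_nth ?su ?cat_take_drop.
  rewrite [X in mass b 0 X]Eu [X in count_mem true X == j.+1]Eu.
  rewrite /del !count_cat /= add1n addnS eqSS; case: ifP => // _.
  exact: mass_delete.
apply: leq_trans (_ : \sum_(p < n.+1) level b n j <= _)%N; last first.
  by rewrite sum_nat_const card_ord.
apply: leq_trans (leq_sum _ (fun (p : 'I__) _ => E p (ltn_ord p))).
rewrite /level big_distrr /=.
under [X in (_ <= X)%N]eq_bigr do rewrite big_mkcondr.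
rewrite exchange_big /= big_seq_cond [X in (_ <= X)%N]big_seq_cond.
apply: leq_sum => u; case/andP=> uw /eqP cu; have su := size_words uw.
rewrite -big_mkcond /= sum_nat_const leq_mul2r; apply/orP; right.
rewrite -cu -sum1_count (big_nth false) su big_mkord sum1_card.
by apply: subset_leq_card; apply/subsetP => p; rewrite !unfold_in /=; case: (nth _ _ _).
Qed.

Lemma level0 b n j : (sumn b <= j)%N -> level b n j = 0%N.
Proof.
move=> leRj; apply: big1 => u /eqP cu; apply: big1 => i _.
case: (boolP (surv _ _ _)) => // /surv_count; rewrite sumn_rot cu; lia.
Qed.

(** * Binary words and addition with carry *)

Fixpoint nat_of_word (l : seq bool) : nat :=
  if l is t :: l' then (t + 2 * nat_of_word l')%N else 0%N.

Lemma wordS k n : word k.+1 n = odd n :: word k n./2.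
Proof.
rewrite /word /mkseq /= /bit expn0 divn1; congr (_ :: _).
rewrite (iotaDl 1 0) -map_comp; apply: eq_map => i /=.
by rewrite add1n expnS divnMA divn2.
Qed.

Lemma half_lt_exp k n : (n < 2 ^ k.+1)%N -> (n./2 < 2 ^ k)%N.
Proof. by rewrite expnS -divn2; lia. Qed.

Lemma word_nat k n : (n < 2 ^ k)%N -> nat_of_word (word k n) = n.
Proof.
elim: k n => [|k IH] n ltn; first by case: n ltn.
by rewrite wordS /= IH ?half_lt_exp // mul2n odd_double_half.
Qed.

Lemma count_word k m n : (n < 2 ^ k)%N -> (n < 2 ^ m)%N ->
  count_mem true (word k n) = count_mem true (word m n).
Proof.
have zero j : count_mem true (word j 0) = 0%N by elim: j => // j IH; rewrite wordS.
elim: k m n => [|k IH] [|m] n ltk ltm.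
- by [].
- by case: n ltk {ltm} => // _; rewrite [RHS]zero.
- by case: n ltm {ltk} => // _; rewrite [LHS]zero.
by rewrite !wordS /= (IH m) ?half_lt_exp.
Qed.

Lemma wt_word k n : (n < 2 ^ k)%N -> wt n = count_mem true (word k n).
Proof.
move=> ltk; apply: count_word => //; case: n {ltk} => [|n] //.
by case/andP: (trunc_log_bounds (isT : 1 < 2)%N (ltn0Sn n)).
Qed.

Lemma wt_full k : wt (2 ^ k - 1) = k.
Proof.
rewrite (@wt_word k); last by have := expn_gt0 2 k; lia.
elim: k => // k IH; rewrite wordS /= (_ : (2 ^ k.+1 - 1)./2 = 2 ^ k - 1)%N.
  rewrite IH (_ : odd _ = true) //.
  by rewrite oddB ?expn_gt0 // oddX.
by rewrite expnS -divn2; have := expn_gt0 2 k; lia.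
Qed.

Lemma sum_words (V : nmodType) k (F : seq bool -> V) :
  \sum_(u <- words k) F u = \sum_(0 <= n < 2 ^ k) F (word k n).
Proof.
elim: k F => [|k IH] F; first by rewrite big_seq1 expn0 big_nat1.
have dbl m (G : nat -> V) :
    \sum_(0 <= n < 2 * m) G n = \sum_(0 <= n < m) G (2 * n)%N + \sum_(0 <= n < m) G (2 * n).+1.
  elim: m => [|m IHm]; first by rewrite muln0 !big_geq ?addr0.
  rewrite (_ : 2 * m.+1 = (2 * m).+2)%N; last by lia.
  rewrite [LHS]big_nat_recr // [X in X + _ = _]big_nat_recr // IHm.
  by rewrite !(big_nat_recr m) //= -!addrA; congr (_ + _); rewrite addrCA.
rewrite sum_wordsS !IH expnS dbl; congr (_ + _); apply: eq_bigr => n _;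
  by rewrite wordS mul2n /= odd_double ?uphalf_double ?doubleK.
Qed.

Lemma transfer_addition (l : seq bool) (c d : bool) :
  transfer (1 : {poly int}) 'X^2 ('X *+ 2) l c d =
  \sum_(u <- words (size l)) \sum_(u' <- words (size l))
    (nat_of_word u + nat_of_word u' + c == nat_of_word l + 2 ^ size l * d)%N%:R *
    'X^(count_mem true u + count_mem true u').
Proof.
elim: l c d => [|t l IH] c d.
  by rewrite /= !big_seq1 expr0 mulr1; case: c d => [] [].
rewrite [size _]/= sum_wordsS.
under eq_bigr do rewrite sum_wordsS.
under [X in _ + X]eq_bigr do rewrite sum_wordsS.
rewrite !big_split /=.
(* Digits compatible with the carries leave the same problem one digit shorter. *)
have E (a a' c' : bool) : (a + a' + c = t + 2 * c')%N ->
   \sum_(u <- words (size l)) \sum_(u' <- words (size l))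
    (a + 2 * nat_of_word u + (a' + 2 * nat_of_word u') + c == t + 2 * nat_of_word l + 2 ^ (size l).+1 * d)%N%:R *
    'X^(a + count_mem true u + (a' + count_mem true u'))%N =
   'X^(a + a') * transfer (1 : {poly int}) 'X^2 ('X *+ 2) l c' d.
  move=> H; rewrite IH big_distrr; apply: eq_bigr => u _; rewrite big_distrr.
  apply: eq_bigr => u' _ /=; rewrite (addnACA a (count_mem _ _)) exprD expnS -mulnA mulrCA.
  congr (_ * (_%:R * _)); move: (2 ^ size l * d)%N => W.
  by apply/eqP/eqP; lia.
(* A digit sum of the wrong parity admits no solution. *)
have N (a a' e : bool) : (a + a' + c + t = 2 * e + 1)%N ->
   \sum_(u <- words (size l)) \sum_(u' <- words (size l))
    (a + 2 * nat_of_word u + (a' + 2 * nat_of_word u') + c == t + 2 * nat_of_word l + 2 ^ (size l).+1 * d)%N%:R *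
    'X^(a + count_mem true u + (a' + count_mem true u'))%N = 0 :> {poly int}.
  move=> H; rewrite big1 // => u _; rewrite big1 // => u' _.
  rewrite expnS -mulnA (_ : (_ == _)%N = false) ?mul0r //.
  by move: (2 ^ size l * d)%N => W; apply/negbTE/eqP; lia.
have [ct|ct] := eqVneq c t.
  rewrite (N false true c); last by rewrite ct; case: (t).
  rewrite (N true false c); last by rewrite ct; case: (t).
  rewrite (E false false false); last by rewrite ct; case: (t).
  rewrite (E true true true); last by rewrite ct; case: (t).
  by rewrite addr0 add0r expr0.
rewrite (N false false false) ?addn0; last by move: ct; case: (c); case: (t).
rewrite (N true true true); last by move: ct; case: (c); case: (t).
rewrite (E false true c); last by move: ct; case: (c); case: (t).
rewrite (E true false c); last by move: ct; case: (c); case: (t).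
by rewrite addr0 add0r addn0 add0n !expr1; ring.
Qed.

(** * Coefficients below degree [k], and the cardinality of [Stk] *)

Definition low (k : nat) (p : {poly int}) : int := \sum_(0 <= e < k) p`_e.

Lemma lowD k p q : low k (p + q) = low k p + low k q.
Proof. by rewrite -big_split; apply: eq_bigr => e _; rewrite coefD. Qed.

Lemma lowB k p q : low k (p - q) = low k p - low k q.
Proof. by rewrite /low -sumrB; apply: eq_bigr => e _; rewrite coefB. Qed.

Lemma lowMn k p n : low k (p *+ n) = low k p *+ n.
Proof. by rewrite /low -sumrMnl; apply: eq_bigr => e _; rewrite coefMn. Qed.

Lemma low_sum k I (r : seq I) (P : pred I) (F : I -> {poly int}) :
  low k (\sum_(i <- r | P i) F i) = \sum_(i <- r | P i) low k (F i).
Proof.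
rewrite /low exchange_big; apply: eq_bigr => e _; exact: coef_sum.
Qed.

Lemma low_natXn k (m n : nat) : low k (m%:R * 'X^n) = (m * (n < k)%N)%:R.
Proof.
rewrite /low; under eq_bigr do rewrite mulr_natl coefMn coefXn.
elim: k => [|k IH]; first by rewrite big_geq ?ltn0 ?muln0.
rewrite big_nat_recr //= IH ltnS.
by case: (ltngtP n k) => _; rewrite ?muln0 ?muln1 ?mul0rn ?addr0 ?add0r.
Qed.

Lemma low_Xn k n : low k 'X^n = (n < k)%N%:R.
Proof. by have := low_natXn k 1 n; rewrite mul1r mul1n. Qed.

(** The factor is [-(1 - X)^2]. A sum of initial coefficients is one coefficient of the quotient by
    [1 - X], here [-(1 - X) q]. *)
Lemma low_telescope k (q : {poly int}) :
  low k.+2 (('X *+ 2 - 1 - 'X^2) * q) = q`_k - q`_k.+1.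
Proof.
have -> : ('X *+ 2 - 1 - 'X^2) * q = q * 'X *+ 2 - q - q * 'X^2 by ring.
elim: k => [|k IH]; rewrite /low big_nat_recr //.
  rewrite big_nat1 /= !coefB !coefMn !coefMX !coefMXn /=; ring.
rewrite -/(low k.+2 _) IH !coefB !coefMn coefMX coefMXn /= subn2 /=; ring.
Qed.

(** The congruence means [a + b = t] or [a + b = t + 2 ^ k - 1]; the second case is a carry going
    around from the top digit to the lowest. *)
Lemma card_Stk k t : (t < 2 ^ k - 1)%N ->
  #|Stk t k| =
  (\sum_(u <- words k) \sum_(u' <- words k)
    ((nat_of_word u + nat_of_word u' == t) +
     (nat_of_word u + nat_of_word u' + 1 == t + 2 ^ k)) *
    (count_mem true u + count_mem true u' < k))%N.
Proof.
move=> lttN; have k2 : (2 ^ k = (2 ^ k - 1).+1)%N by have := expn_gt0 2 k; lia.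
set N := (2 ^ k - 1)%N in lttN k2.
pose F a b := (((a + b == t) + (a + b + 1 == t + N.+1)) * (wt a + wt b < k))%N.
have -> : (\sum_(u <- words k) \sum_(u' <- words k)
    ((nat_of_word u + nat_of_word u' == t) +
     (nat_of_word u + nat_of_word u' + 1 == t + 2 ^ k)) *
    (count_mem true u + count_mem true u' < k) =
    \sum_(0 <= a < 2 ^ k) \sum_(0 <= b < 2 ^ k) F a b)%N.
  rewrite (@sum_words nat); apply: eq_big_nat => a /andP[_ lta].
  rewrite (@sum_words nat); apply: eq_big_nat => b /andP[_ ltb].
  by rewrite !word_nat // -!wt_word // /F -k2.
(* The word of [k] ones stands for [N], outside the index range, but its weight [k] already excludes
   it. *)
have F0 a : (F a N = 0)%N by rewrite /F wt_full ltnNge leq_addl muln0.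
have F0' b : (F N b = 0)%N by rewrite /F wt_full ltnNge leq_addr muln0.
rewrite [in RHS]k2 big_nat_recr //= [X in (_ + X)%N]big1 ?addn0 //.
under eq_bigr do rewrite big_nat_recr //= F0 addn0.
rewrite big_mkord; under eq_bigr do rewrite big_mkord.
rewrite pair_big /= -sum1_card big_mkcond; apply: eq_bigr => -[[a lta] [b ltb]] _ /=.
rewrite inE /= /F; case: (wt a + wt b < k)%N; rewrite ?andbF ?muln0 // andbT muln1.
rewrite (modn_small lttN).
have [lt|ge] := ltnP (a + b) N.
  rewrite modn_small //.
  by rewrite [(a + b + 1 == _)%N](_ : _ = false) ?addn0; [case: eqP | apply/eqP; lia].
rewrite -{1}(subnK ge) modnDr modn_small; last by lia.
rewrite [(a + b == t)%N](_ : _ = false); last by apply/eqP; lia.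
rewrite (_ : (a + b - N == t)%N = (a + b + 1 == t + N.+1)%N); first by case: eqP.
by apply/eqP/eqP; lia.
Qed.

Lemma low_trace k t : (t < 2 ^ k - 1)%N ->
  low k (trace 1 'X^2 ('X *+ 2) (word k t)) = #|Stk t k|%:R.
Proof.
move=> lttN; have szw : size (word k t) = k by rewrite size_mkseq.
rewrite /trace !transfer_addition szw word_nat; last by lia.
rewrite lowD !low_sum -big_split card_Stk // natr_sum.
apply: eq_bigr => u _; rewrite !low_sum -big_split natr_sum.
by apply: eq_bigr => u' _; rewrite /= !low_natXn !addn0 muln0 muln1 -natrD -mulnDl addn0.
Qed.

(** * The two coefficients left by telescoping, and their comparison *)

Definition gen_wsum (N : nat) (F : seq bool -> bool) : {poly int} :=
  wsum 1 'X^2 ('X *+ 2) N F.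

Lemma coef_wsum (F : seq bool -> bool) N e :
  (gen_wsum N F)`_e =
  (\sum_(0 <= n < N) 2 ^ (N - n.+1) *
    \sum_(u <- words n | N - n.+1 + 2 * count_mem true u == e) F u)%:R :> int.
Proof.
rewrite /gen_wsum wsum_words coef_sum natr_sum; apply: eq_bigr => n _.
rewrite coef_sum natrM natr_sum big_distrr [in RHS]big_mkcond /=.
apply: eq_bigr => u _; rewrite expr1n mulr1 -exprM.
have -> (a m c : nat) : (c%:R : {poly int}) * ('X *+ 2) ^+ a * 'X^m =
    (2 ^ a * c)%:R * 'X^(a + m).
  by rewrite exprMn_n -[X in _ * X * _]mulr_natl exprD [in RHS]mulnC natrM !mulrA.
rewrite mulr_natl coefMn coefXn eq_sym.
by case: ifP => _; rewrite ?mulr0 ?mul0rn // natrM.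
Qed.

(* The total mass of the words of length [n] with [d] more zeros than ones. *)
Definition excess b d n : nat :=
  (\sum_(u <- words n | 2 * count_mem true u + d == n) mass b 0 u)%N.

Lemma excess_level b j d : excess b d (2 * j + d)%N = level b (2 * j + d)%N j.
Proof. by apply: eq_bigl => u; apply/eqP/eqP; lia. Qed.

Lemma excess_parity b d n : (forall j, n != (2 * j + d)%N) -> excess b d n = 0%N.
Proof.
move=> H; apply: big1 => u /eqP cu.
by have := H (count_mem true u); rewrite cu eqxx.
Qed.

(** For [n = 2j + 1] the ratio in [level_step] is [(2j + 2) / (j + 1) = 2]; for even [n] the left
    side is an empty sum. *)
Lemma excess_step b n : (excess b 0 n.+1 <= 2 * excess b 1 n)%N.
Proof.
have [/eqP n0|n1] := boolP (n %% 2 == 0)%N.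
  by rewrite excess_parity // => j; apply/eqP; lia.
have -> : n = (2 * (n %/ 2) + 1)%N by lia.
move: (n %/ 2)%N => {n n1} j; rewrite excess_level.
rewrite (_ : (2 * j + 1).+1 = 2 * j.+1 + 0)%N ?excess_level; last by lia.
have := level_step b (2 * j + 1)%N j.
rewrite (_ : 2 * j.+1 + 0 = (2 * j + 1).+1)%N; last by lia.
by rewrite (_ : (2 * j + 1).+1 = 2 * j.+1)%N ?leq_pmul2l // ?mulnA; nia.
Qed.

(** A word of length [n] with [c] ones gets degree [k - n - 1 + 2c], which is [k - d - 1] exactly
    when [n = 2c + d]. *)
Lemma low_wsum b k d : (d <= 1)%N -> (1 < k)%N ->
  \sum_(i < size b) (gen_wsum k (surv (rot i b) 0))`_(k - d.+1)%N =
  (\sum_(0 <= n < k) 2 ^ (k - n.+1) * excess b d n)%:R :> int.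
Proof.
move=> d1 k1.
rewrite (eq_bigr _ (fun (i : 'I__) _ => coef_wsum (surv (rot i b) 0) k (k - d.+1)%N)).
rewrite -natr_sum exchange_big /=; congr (_%:R); apply: eq_big_nat => n /andP[_ ltnk].
rewrite -big_distrr /=; congr (_ * _)%N; rewrite exchange_big.
apply: eq_bigl => u; move: (count_mem _ _) => c. apply/eqP/eqP; lia.
Qed.

Lemma ge_level b n : (n < sumn b)%N -> (n.+1 < size b)%N ->
  (size b <= level b (2 * n + 1) n)%N.
Proof.
move=> ltnR ltnZ; pose u := nseq n.+1 false ++ nseq n true.
have uw : u \in words (2 * n + 1).
  by have := mem_words u; rewrite size_cat !size_nseq (_ : n.+1 + n = 2 * n + 1)%N //; lia.
rewrite /level (big_rem u) //= count_cat !count_nseq /= mul0n mul1n eqxx.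
by rewrite mass_full // leq_addr.
Qed.

Lemma excess_bound b k : (0 < sumn b)%N -> (sumn b < size b)%N -> k = (size b + sumn b)%N ->
  (\sum_(0 <= n < k) 2 ^ (k - n.+1) * excess b 0 n + 2 * size b <=
   2 ^ (k - 1) * size b + \sum_(0 <= n < k) 2 ^ (k - n.+1) * excess b 1 n)%N.
Proof.
move=> R0 RZ; case: k => [|k] ek; first by lia.
(* The empty word on the left is paid for by the first term on the right; then term [n.+1] on the
   left faces term [n] on the right, whose last term is dropped. *)
rewrite big_nat_recl // big_nat_recr //= subn1 -addnA.
apply: leq_add; first by rewrite leq_mul2l /excess big_mkcond big_seq1 mass_le orbT.
apply: leq_trans (leq_addr _ _).
(* With [R = sumn b], the right side at length [2R - 1] counts words with [R] zeros and [R - 1]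
   ones, while the left term facing it needs [R] ones and so vanishes. *)
pose n0 := (2 * (sumn b).-1 + 1)%N; have ltn0k : (n0 < k)%N by rewrite /n0; lia.
rewrite !big_mkord (bigD1 (Ordinal ltn0k)) // [X in (_ <= X)%N](bigD1 (Ordinal ltn0k)) //=.
rewrite addnAC; apply: leq_add; last first.
  apply: leq_sum => i _; have ltik := ltn_ord i.
  rewrite subSS (_ : k.+1 - i.+1 = (k - i.+1).+1)%N; last by lia.
  by rewrite expnS -mulnA mulnCA leq_mul2l excess_step orbT.
have -> : excess b 0 n0.+1 = 0%N.
  rewrite (_ : n0.+1 = 2 * sumn b + 0)%N ?excess_level ?level0 // /n0; lia.
rewrite muln0 add0n /n0 excess_level.
apply: leq_mul; last by apply: ge_level; lia.
(* The exponent is positive because [sumn b < size b]; this gives the factor 2. *)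
by rewrite -{1}(expn1 2) leq_exp2l //; lia.
Qed.

(** * Opening the word of [t] at a zero, and the final count *)

Lemma encode_cat b1 b2 : encode (b1 ++ b2) = encode b1 ++ encode b2.
Proof. by rewrite /encode map_cat flatten_cat. Qed.

Lemma defect_encode_rot (R : comNzRingType) (x w v : R) i b :
  defect x w v (encode (rot i b)) = defect x w v (encode b).
Proof. by rewrite /rot encode_cat defect_rot -encode_cat cat_take_drop. Qed.

Lemma ones_encode l : exists a b, l = nseq a true ++ encode b.
Proof.
elim: l => [|[] l [a [b ->]]]; first by exists 0%N, [::].
  by exists a.+1, b.
by exists 0%N, (a :: b).
Qed.

Lemma rot_encode l : false \in l ->
  exists b s1 s2, l = s1 ++ s2 /\ encode b = s2 ++ s1.
Proof.
have [a [[|i b] ->]] := ones_encode l; first by rewrite cats0 mem_nseq andbF.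
(* Once the leading ones are moved to the end the word begins with 0, so its own leading run of ones
   is empty. *)
move=> _; have [[|a'] [b' E]] := ones_encode (encode (i :: b) ++ nseq a true).
  by exists b', (nseq a true), (encode (i :: b)); rewrite E.
by [].
Qed.

Lemma trace_lt_half l (s : nat) : (0 < count_mem true l)%N ->
  (count_mem true l < count_mem false l)%N ->
  low (size l) (trace 1 'X^2 ('X *+ 2) l) = s%:R -> (s < 2 ^ (size l - 1))%N.
Proof.
move=> R0 RZ lowtr.
have [|b [s1 [s2 [El Eb]]]] := @rot_encode l.
  by rewrite -has_pred1 has_count; lia.
have cnt t : count_mem t l = count_mem t (encode b) by rewrite El Eb !count_cat addnC.
have ek : size l = (size b + sumn b)%N by rewrite El -size_encode Eb !size_cat addnC.
move: R0 RZ; rewrite !cnt !count_encode => R0 RZ.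
have def_l : defect 1 'X^2 ('X *+ 2) l = defect (1 : {poly int}) 'X^2 ('X *+ 2) (encode b).
  by rewrite El Eb defect_rot.
have := sum_defect (1 : {poly int}) 'X^2 ('X *+ 2) (leq0n (size b)).
under eq_bigr do rewrite circle0 defect_encode_rot -def_l.
rewrite sumr_const card_ord subn0 -ek => /(congr1 (low (size l))).
(* The term [v ^+ size l] has degree too large to count, while [x^Z w^R = X^(2R)] counts 1 because
   [2R < R + Z]. *)
have -> : low (size l) (defect 1 'X^2 ('X *+ 2) l *+ size b) = (1 - s%:R) *+ size b.
  rewrite lowMn /defect lowD lowB lowtr exprMn_n expr1n mul1r -exprM.
  rewrite -[_ *+ (2 ^ _)]mulr_natl low_natXn ltnn muln0 low_Xn.
  rewrite (_ : _ < _)%N; first by rewrite add0r addrC.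
  by rewrite cnt count_encode; lia.
move: (excess_bound R0 RZ ek); move: (2 ^ (size l - 1))%N => P.
have [k ->] : exists k, size l = k.+2 by exists (size l - 2)%N; lia.
rewrite low_telescope !coef_sum.
have := low_wsum b (leqnn 1) (_ : (1 < k.+2)%N) => /(_ isT).
have := low_wsum b (leq0n 1) (_ : (1 < k.+2)%N) => /(_ isT).
rewrite /gen_wsum !subSS !subn0 => -> ->.
move: (\sum_(0 <= n < _) _)%N (\sum_(0 <= n < _) _)%N => A B le.
rewrite -mulr_natr => E.
(* Here [A] collects excess 1 and [B] excess 0. From [size b * s = size b + B - A] and
   [excess_bound], [size b * s] is at most [(P - 1) * size b]. *)
have : (size b + B)%:R = (size b * s + A)%:R :> int.
  have -> : (size b * s + A)%:R = (size b)%:R * s%:R + ((1 - s%:R) * (size b)%:R + B%:R) :> int.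
    by rewrite E natrD natrM; ring.
  by rewrite natrD; ring.
move/eqP; rewrite Num.Theory.eqr_nat => /eqP EN.
have Z0 : (0 < size b)%N by lia.
nia.
Qed.

Lemma count_nat_of_word l : (0 < nat_of_word l)%N -> (0 < count_mem true l)%N.
Proof. by elim: l => [|[] l IH] //=; rewrite !add0n muln_gt0. Qed.

Local Close Scope ring_scope.

Theorem lemma7p1 (k t : nat) (hk : 2 <= k) (ht1 : 1 <= t) (ht2 : t < 2 ^ k - 1)
  (hRZ : count_mem true (word k t) < count_mem false (word k t)) :
  #|Stk t k| < 2 ^ (k - 1).
Proof.
have szw : size (word k t) = k by rewrite size_mkseq.
rewrite -szw; apply: trace_lt_half => //; last by rewrite szw low_trace.
by apply: count_nat_of_word; rewrite word_nat //; lia.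
Qed.
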